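(* Let $\mathbb{F}=\mathbb{F}_q$ and let $\mathcal{C}\subseteq\mathbb{F}((z))^n$ be an $(n,k,\delta;m)_q$-MDS convolutional code, that is, an $(n,k,\delta;m)_q$-convolutional code with $$d:=\mathrm{dist}(\mathcal{C})=(n-k)\left(\left\lfloor\frac{\delta}{k}\right\rfloor+1\right)+\delta+1.$$ Then the field size $q$ satisfies $$q\geq\begin{cases}\dfrac{d}{n-k+1}, & \text{if } [k=1]\text{ or }[k>1\text{ and }km=\delta+1],\\[2ex] d, & \text{if } [k>1\text{ and }km\neq\delta+1].\end{cases}$$
   Context: Let $\mathbb{F}=\mathbb{F}_q$ be the field with $q$ elements, $\mathbb{F}[z]$ its polynomial ring and $\mathbb{F}((z))$ the field of formal Laurent series over $\mathbb{F}$. Convolutional code: an $(n,k,\delta)_q$-convolutional code is a $k$-dimensional subspace $\mathcal{C}$ of $\mathbb{F}((z))^n$ (with $k\geq 1$) of the form $\mathcal{C}=\mathrm{im}\,G:=\{uG\mid u\in\mathbb{F}((z))^k\}$, where $G\in\mathbb{F}[z]^{k\times n}$ is right invertible over $\mathbb{F}[z]$ (there is $\tilde G\in\mathbb{F}[z]^{n\times k}$ with $G\tilde G=I_k$) and $\delta$ is the maximum of the degrees of the $k\times k$ minors of $G$. Such a $G$ is called a generator matrix of $\mathcal{C}$ and $\delta$ the complexity of $\mathcal{C}$; it does not depend on the choice of $G$. Memory: the degree of a nonzero $v=\sum_{j=0}^N v_jz^j\in\mathbb{F}[z]^n$ with $v_j\in\mathbb{F}^n$, $v_N\neq 0$ is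 $N$. A generator matrix $G$ with row degrees $\nu_1,\ldots,\nu_k$ is called minimal if $\delta=\sum_{i=1}^k\nu_i$. Every convolutional code has a minimal generator matrix, and the row degrees of a minimal generator matrix (the Forney indices) are uniquely determined by the code up to order. The memory of the code is $m=\max\{\nu_1,\ldots,\nu_k\}$ (so $km\geq\delta$). An $(n,k,\delta)_q$-code with memory $m$ is called an $(n,k,\delta;m)_q$-code. Distance: for $w\in\mathbb{F}^n$ let $\mathrm{wt}(w)$ be the number of nonzero entries of $w$; for $v=\sum_j v_jz^j\in\mathbb{F}[z]^n$ with $v_j\in\mathbb{F}^n$ let $\mathrm{wt}(v)=\sum_j\mathrm{wt}(v_j)$. The (free) distance is $\mathrm{dist}(\mathcal{C})=\min\{\mathrm{wt}(v)\mid v\in\mathcal{C}\cap\mathbb{F}[z]^n,\ v\neq 0\}$. MDS codes: it is known (Rosenthal–Smarandache) that every $(n,k,\delta)$-convolutional code satisfies $\mathrm{dist}(\mathcal{C})\leq S(n,k,\delta):=(n-k)\left(\lfloor\delta/k\rfloor+1\right)+\delta+1$ (generalized Singleton bound); the code is called an MDS code if equality holds. It is also known that, writing $\delta=ak+r$ with $a\geq 0$ and $0\leq r\leq k-1$, the Forney indices of an MDS code are $a$ ($k-r$ times) and $a+1$ ($r$ times). *)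

(* Defs.v *)
From HB Require Import structures.
From mathcomp Require Import all_boot all_order all_algebra.
From mathcomp Require Import boolp classical_sets functions cardinality fsbigop.
From mathcomp Require Import zify.

Set Implicit Arguments.
Unset Strict Implicit.
Unset Printing Implicit Defensive.

Import Order.TTheory GRing.Theory Num.Theory.
Local Open Scope ring_scope.

Section LaurentType.
Variable F : fieldType.

Definition bounded_below (f : int -> F) : Prop :=
  exists N : int, forall i : int, i < N -> f i = 0.

Record laurent : Type := Laurent
  { lcoef :> int -> F; _ : `[< bounded_below lcoef >] }.

HB.instance Definition _ := [isSub for lcoef].
HB.instance Definition _ := [Choice of laurent by <:].

Lemma laurentP (f g : laurent) : (forall i, f i = g i) -> f = g.
Proof. by move=> fg; apply: val_inj; apply/funext. Qed.

Lemma laurent_bounded (f : laurent) :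
  exists N : int, forall i : int, i < N -> f i = 0.
Proof. by case: f => f /= /asboolP. Qed.

Lemma laurent_bounded2 (f g : laurent) :
  exists N : int, forall i : int, i < N -> f i = 0 /\ g i = 0.
Proof.
have [N fN] := laurent_bounded f; have [M gM] := laurent_bounded g.
by exists (Num.min N M) => i; rewrite lt_min => /andP[/fN-> /gM->].
Qed.

Definition mk_laurent (f : int -> F) (fb : bounded_below f) : laurent :=
  Laurent (introT (asboolP _) fb).

Lemma lzero_subproof : bounded_below (fun=> 0).
Proof. by exists 0. Qed.
Definition lzero := mk_laurent lzero_subproof.

Lemma lone_subproof : bounded_below (fun i => (i == 0)%:R).
Proof. by exists 0 => i; case: eqVneq => // ->; rewrite ltxx. Qed.
Definition lone := mk_laurent lone_subproof.

Lemma lopp_subproof (f : laurent) : bounded_below (fun i => - f i).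
Proof.
by have [N fN] := laurent_bounded f; exists N => i /fN ->; rewrite oppr0.
Qed.
Definition lopp (f : laurent) := mk_laurent (lopp_subproof f).

Lemma ladd_subproof (f g : laurent) : bounded_below (fun i => f i + g i).
Proof.
have [N fgN] := laurent_bounded2 f g.
by exists N => i /fgN[-> ->]; rewrite addr0.
Qed.
Definition ladd (f g : laurent) := mk_laurent (ladd_subproof f g).

(* The Cauchy product; the sum is over all of int, and finitely supported
   because f and g are both bounded below. *)
Definition lmul_coef (f g : laurent) (k : int) : F :=
  \sum_(i \in [set: int]) f i * g (k - i).

Definition ltrunc (f : laurent) (N : int) (L : nat) : {poly F} :=
  \poly_(i < L) f (N + i%:Z).

Lemma lmul_coef_lt (f g : laurent) (N M k : int) :
  (forall i, i < N -> f i = 0) -> (forall i, i < M -> g i = 0) ->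
  k < N + M -> lmul_coef f g k = 0.
Proof.
move=> fN gM kNM; rewrite /lmul_coef fsbig1 // => i _.
have [iN|Ni] := ltP i N; first by rewrite fN // mul0r.
by rewrite gM ?mulr0 //; lia.
Qed.

Lemma lmul_coefE (f g : laurent) (N M : int) (L m : nat) :
  (forall i, i < N -> f i = 0) -> (forall i, i < M -> g i = 0) ->
  (m < L)%N ->
  lmul_coef f g (N + M + m%:Z) = (ltrunc f N L * ltrunc g M L)`_m.
Proof.
move=> fN gM mL; rewrite coefM /lmul_coef.
rewrite (reindex_fsbigT (fun i : int => N + i)); last first.
  exists (fun i : int => i - N) => i; last by rewrite addrC subrK.
  by rewrite addrC addrA addNr add0r.
rewrite -(@fsbig_widen _ _ _ _ [set` [seq Posz i | i <- iota 0 m.+1]]%classic);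
  last 2 first.
- by [].
- move=> i [_ iNm]; change (f (N + i) * g (N + M + m%:Z - (N + i)) = 0).
  have [i0|i0] := ltP i 0; first by rewrite fN ?mul0r //; lia.
  rewrite gM ?mulr0 //.
  have : (m%:Z < i).
    rewrite ltNge; apply/negP => im; apply: iNm.
    have -> : i = Posz `|i|%N by lia.
    by apply: (map_f Posz); rewrite mem_iota; lia.
  lia.
rewrite -fsbig_seq; last by rewrite map_inj_uniq ?iota_uniq // => i j [].
rewrite big_map -[iota 0 m.+1]/(index_iota 0 m.+1) big_mkord.
apply: eq_bigr => i _; rewrite !coef_poly.
have -> : (i < L)%N by have := ltn_ord i; lia.
have -> : (m - i < L)%N by lia.
by congr (_ * g _); have := ltn_ord i; lia.
Qed.

Lemma lmul_subproof (f g : laurent) : bounded_below (lmul_coef f g).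
Proof.
have [N fN] := laurent_bounded f; have [M gM] := laurent_bounded g.
by exists (N + M) => k; apply: lmul_coef_lt.
Qed.
Definition lmul (f g : laurent) := mk_laurent (lmul_subproof f g).

Lemma laddA : associative ladd.
Proof. by move=> f g h; apply: laurentP => i; apply: addrA. Qed.
Lemma laddC : commutative ladd.
Proof. by move=> f g; apply: laurentP => i; apply: addrC. Qed.
Lemma ladd0 : left_id lzero ladd.
Proof. by move=> f; apply: laurentP => i; apply: add0r. Qed.
Lemma laddN : left_inverse lzero lopp ladd.
Proof. by move=> f; apply: laurentP => i; apply: addNr. Qed.

HB.instance Definition _ := GRing.isZmodule.Build laurent laddA laddC ladd0 laddN.

Lemma laurent_eq (f g : laurent) (N : int) :
  (forall i, i < N -> f i = 0) -> (forall i, i < N -> g i = 0) ->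
  (forall m : nat, f (N + m%:Z) = g (N + m%:Z)) -> f = g.
Proof.
move=> fN gN fg; apply: laurentP => i.
have [iN|Ni] := ltP i N; first by rewrite fN ?gN.
have -> : i = N + `|i - N|%N%:Z by lia.
exact: fg.
Qed.

Lemma lmul_lt (f g : laurent) (N M : int) :
  (forall i, i < N -> f i = 0) -> (forall i, i < M -> g i = 0) ->
  forall i, i < N + M -> lmul f g i = 0.
Proof. by move=> fN gM i; apply: lmul_coef_lt. Qed.

Lemma coef_lmul (f g : laurent) (N M : int) (L m : nat) :
  (forall i, i < N -> f i = 0) -> (forall i, i < M -> g i = 0) ->
  (m < L)%N ->
  lmul f g (N + M + m%:Z) = (ltrunc f N L * ltrunc g M L)`_m.
Proof. exact: lmul_coefE. Qed.

Lemma coefM_ext (p p' q q' : {poly F}) (m : nat) :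
  (forall i, (i <= m)%N -> p`_i = p'`_i) ->
  (forall i, (i <= m)%N -> q`_i = q'`_i) -> (p * q)`_m = (p' * q')`_m.
Proof.
move=> pp' qq'; rewrite !coefM; apply: eq_bigr => i _.
by rewrite pp' ?qq' ?leq_subr // -ltnS.
Qed.

Lemma lmulC : commutative lmul.
Proof.
move=> f g.
have [N fN] := laurent_bounded f; have [M gM] := laurent_bounded g.
apply: (@laurent_eq _ _ (N + M)); first exact: lmul_lt.
  by rewrite addrC; apply: lmul_lt.
move=> m; rewrite (coef_lmul fN gM (ltnSn m)) mulrC.
by rewrite [N + M]addrC (coef_lmul gM fN (ltnSn m)).
Qed.

Lemma lmulA : associative lmul.
Proof.
move=> f g h.
have [N fN] := laurent_bounded f; have [M gM] := laurent_bounded g.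
have [P hP] := laurent_bounded h.
have fgN := lmul_lt fN gM; have ghN := lmul_lt gM hP.
apply: (@laurent_eq _ _ (N + M + P)); last 1 first.
- move=> m; rewrite (coef_lmul fgN hP (ltnSn m)).
  rewrite -[N + M + P]addrA (coef_lmul fN ghN (ltnSn m)).
  transitivity ((ltrunc f N m.+1 * (ltrunc g M m.+1 * ltrunc h P m.+1))`_m).
    apply: coefM_ext => // i im; rewrite coef_poly ltnS im.
    exact: coef_lmul.
  rewrite mulrA; apply: coefM_ext => // i im; rewrite [RHS]coef_poly ltnS im.
  by symmetry; apply: coef_lmul.
- by rewrite -addrA; apply: lmul_lt.
- exact: lmul_lt.
Qed.

Lemma lone_lt (i : int) : i < 0 -> lone i = 0.
Proof. by rewrite /=; case: eqVneq => // ->; rewrite ltxx. Qed.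

Lemma lmul1 : left_id lone lmul.
Proof.
move=> f; have [N fN] := laurent_bounded f.
apply: (@laurent_eq _ _ (0 + N)); first exact: (lmul_lt lone_lt fN).
  by rewrite add0r.
move=> m; rewrite (coef_lmul lone_lt fN (ltnSn m)).
have -> : ltrunc lone 0 m.+1 = 1.
  apply/polyP => i; rewrite coef_poly coef1 /= add0r.
  by case: i => [|i]; rewrite //= ?if_same.
by rewrite mul1r coef_poly ltnSn add0r.
Qed.

Lemma lmulDl : left_distributive lmul ladd.
Proof.
move=> f g h; have [N fgN] := laurent_bounded2 f g.
have [M hM] := laurent_bounded h.
have fN i : i < N -> f i = 0 by case/fgN.
have gN i : i < N -> g i = 0 by case/fgN.
have fgN' i : i < N -> ladd f g i = 0 by move=> /fgN[] /= -> ->; rewrite addr0.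
apply: (@laurent_eq _ _ (N + M)); first exact: lmul_lt.
  by move=> i iNM /=; rewrite (lmul_coef_lt fN hM) ?(lmul_coef_lt gN hM) ?addr0.
move=> m; rewrite (coef_lmul fgN' hM (ltnSn m)) /=.
rewrite (lmul_coefE fN hM (ltnSn m)) (lmul_coefE gN hM (ltnSn m)).
rewrite -coefD -mulrDl; congr ((_ * _ : {poly F})`_m).
apply/polyP => i; rewrite coefD !coef_poly /=.
by case: ifP; rewrite ?addr0.
Qed.

Lemma lone_neq0 : lone != 0 :> laurent.
Proof.
apply/eqP => /(congr1 (fun f : laurent => f 0)) /eqP.
by rewrite -[lone 0]/(1 : F) -[(0 : laurent) 0]/(0 : F) oner_eq0.
Qed.

HB.instance Definition _ := GRing.Zmodule_isComNzRing.Build laurent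
  lmulA lmulC lmul1 lmulDl lone_neq0.

(* the first n coefficients of the inverse of the power series \sum_i a i z^i *)
Fixpoint psinv (a : nat -> F) (n : nat) : seq F :=
  if n is n'.+1 then
    let s := psinv a n' in
    rcons s ((a 0)^-1 * ((n' == 0)%:R - \sum_(i < n') a (n' - i)%N * s`_i))
  else [::].

Lemma size_psinv a n : size (psinv a n) = n.
Proof. by elim: n => //= n IH; rewrite size_rcons IH. Qed.

Lemma psinv_nth a n i : (i < n)%N -> (psinv a n)`_i = (psinv a i.+1)`_i.
Proof.
elim: n => // n IH; rewrite ltnS leq_eqVlt => /orP[/eqP->//|lt_in].
by rewrite [in LHS]/= nth_rcons size_psinv lt_in IH.
Qed.

Lemma psinvP a m : a 0 != 0 ->
  \sum_(i < m.+1) a (m - i)%N * (psinv a i.+1)`_i = (m == 0)%:R.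
Proof.
move=> a0; rewrite big_ord_recr /= subnn nth_rcons size_psinv ltnn eqxx.
rewrite mulVKf // addrC -addrA [X in _ + X](_ : _ = 0) ?addr0 //.
apply/eqP; rewrite addrC subr_eq0; apply/eqP; apply: eq_bigr => i _.
by rewrite [in RHS]psinv_nth.
Qed.

Lemma laurent_order (f : laurent) : f != 0 ->
  exists N : int, f N != 0 /\ forall i, i < N -> f i = 0.
Proof.
move=> f0; have [N fN] := laurent_bounded f.
have exf : exists m : nat, f (N + m%:Z) != 0.
  apply: contrapT => nf; case/eqP: f0.
  apply: (@laurent_eq _ _ N) => // m; apply: contrapT => /eqP fm.
  by apply: nf; exists m.
case: (ex_minnP exf) => m fm m_min; exists (N + m%:Z); split=> // i im.
have [iN|Ni] := ltP i N; first exact: fN.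
have -> : i = N + `|i - N|%N%:Z by lia.
apply/eqP/negPn/negP => /m_min; lia.
Qed.

Lemma linv_subproof (f : laurent) : f != 0 -> exists g, lmul g f = lone.
Proof.
move=> /laurent_order[N [fN0 fN]].
pose a (i : nat) := f (N + i%:Z).
pose c (i : int) := if i < - N then 0 else (psinv a (absz (i + N)).+1)`_(absz (i + N)).
have cb : bounded_below c by exists (- N) => i iN; rewrite /c iN.
exists (mk_laurent cb).
have gN i : i < - N -> mk_laurent cb i = 0 by move=> iN; rewrite /= /c iN.
apply: (@laurent_eq _ _ (- N + N)); first exact: lmul_lt.
  by rewrite addNr; apply: lone_lt.
move=> m; rewrite (coef_lmul gN fN (ltnSn m)) /= addNr add0r.
have a0 : a 0%N != 0 by rewrite /a addr0.
rewrite -[RHS](psinvP m a0) coefM; apply: eq_bigr => i _.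
rewrite !coef_poly ltn_ord ltnS leq_subr mulrC; congr (_ * _).
rewrite /= /c; have -> : (- N + i%:Z < - N) = false by lia.
by have -> : absz (- N + i%:Z + N) = i by lia.
Qed.

Definition linv (f : laurent) : laurent :=
  if pselect (exists g, lmul g f = lone) is left ex then sval (cid ex) else 0.

Lemma lmulVf (f : laurent) : f != 0 -> linv f * f = 1.
Proof.
move=> /linv_subproof ex; rewrite /linv.
by case: pselect => // ex'; case: (cid ex').
Qed.

Lemma linv0 : linv 0 = 0.
Proof.
rewrite /linv; case: pselect => // -[g g0]; exfalso.
have : g * (0 : laurent) = 1 by [].
by rewrite mulr0 => /esym/eqP; rewrite oner_eq0.
Qed.

HB.instance Definition _ := GRing.ComNzRing_isField.Build laurent lmulVf linv0.

Definition poly_coefz (p : {poly F}) (i : int) : F :=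
  if i is Posz n then p`_n else 0.

Lemma laurent_of_poly_subproof p : bounded_below (poly_coefz p).
Proof. by exists 0 => -[]. Qed.
Definition laurent_of_poly (p : {poly F}) : laurent :=
  mk_laurent (laurent_of_poly_subproof p).

Lemma laurent_of_poly_is_zmod_morphism : zmod_morphism laurent_of_poly.
Proof.
move=> p q; apply: laurentP => -[n|n] /=; first by rewrite coefB.
by rewrite subr0.
Qed.

Lemma laurent_of_poly_is_monoid_morphism : monoid_morphism laurent_of_poly.
Proof.
split=> [|p q].
  by apply: laurentP => -[n|n] //=; rewrite coef1.
have lt0 r i : i < 0 -> laurent_of_poly r i = 0 by case: i.
apply: (@laurent_eq _ _ (0 + 0)); rewrite ?addr0; first exact: lt0.
  exact: (lmul_lt (lt0 p) (lt0 q)).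
move=> m; rewrite -[X in X + _]addr0 (coef_lmul (lt0 p) (lt0 q) (ltnSn m)).
rewrite -[LHS]/((p * q)`_m).
by apply: coefM_ext => i im; rewrite coef_poly ltnS im add0r.
Qed.

HB.instance Definition _ := GRing.isZmodMorphism.Build {poly F} laurent
  laurent_of_poly laurent_of_poly_is_zmod_morphism.
HB.instance Definition _ := GRing.isMonoidMorphism.Build {poly F} laurent
  laurent_of_poly laurent_of_poly_is_monoid_morphism.

End LaurentType.

Arguments laurent F : clear implicits.
Arguments laurent_of_poly {F} p.

Section ConvolutionalCodes.
Variable F : finFieldType.

Definition laurent_mx (m n : nat) (A : 'M[{poly F}]_(m, n)) :
  'M[laurent F]_(m, n) := map_mx laurent_of_poly A.

Definition right_invertible (k n : nat) (G : 'M[{poly F}]_(k, n)) : Prop :=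
  exists H : 'M[{poly F}]_(n, k), G *m H = 1%:M.

(* The maximal degree of the k x k minors of G, one for each choice of k columns
   f 0 < ... < f (k - 1); a zero minor counts for 0, which does not affect the
   maximum when G is right invertible, since then some minor is nonzero. *)
Definition complexity (k n : nat) (G : 'M[{poly F}]_(k, n)) : nat :=
  \max_(f : {ffun 'I_k -> 'I_n} |
      [forall i : 'I_k, forall j : 'I_k, (i < j)%N ==> (f i < f j)%N])
    (size (\det (colsub f G))).-1.

(* The degree N of a nonzero v = \sum_(j <= N) v_j z^j with v_N != 0, that is,
   the largest degree of an entry of v. *)
Definition vdeg (n : nat) (v : 'rV[{poly F}]_n) : nat :=
  \max_(i < n) (size (v 0%R i)).-1.

Definition row_deg (k n : nat) (G : 'M[{poly F}]_(k, n)) (i : 'I_k) : nat :=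
  vdeg (row i G).

Definition is_generator (n k : nat) (C : {vspace 'rV[laurent F]_n})
    (G : 'M[{poly F}]_(k, n)) : Prop :=
  right_invertible G /\
  forall v : 'rV[laurent F]_n,
    v \in C <-> exists u : 'rV[laurent F]_k, v = u *m laurent_mx G.

Definition convolutional_code (n k delta : nat)
    (C : {vspace 'rV[laurent F]_n}) : Prop :=
  [/\ (1 <= k)%N, \dim C = k
    & exists G : 'M[{poly F}]_(k, n), is_generator C G /\ complexity G = delta].

Definition minimal_generator (n k : nat) (C : {vspace 'rV[laurent F]_n})
    (G : 'M[{poly F}]_(k, n)) : Prop :=
  is_generator C G /\ complexity G = (\sum_(i < k) row_deg G i)%N.

Definition has_memory (n k : nat) (C : {vspace 'rV[laurent F]_n}) (m : nat) :
    Prop :=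
  exists G : 'M[{poly F}]_(k, n),
    minimal_generator C G /\ m = (\max_(i < k) row_deg G i)%N.

Definition convolutional_code_mem (n k delta m : nat)
    (C : {vspace 'rV[laurent F]_n}) : Prop :=
  convolutional_code k delta C /\ has_memory k C m.

Definition wt (n : nat) (w : 'rV[F]_n) : nat := #|[set i | w 0 i != 0]|.

Definition vcoef (n : nat) (v : 'rV[{poly F}]_n) (j : nat) : 'rV[F]_n :=
  \row_i (v 0 i)`_j.

Definition pwt (n : nat) (v : 'rV[{poly F}]_n) : nat :=
  (\sum_(j < (vdeg v).+1) wt (vcoef v j))%N.

Definition is_distance (n : nat) (C : {vspace 'rV[laurent F]_n}) (d : nat) :
    Prop :=
  (exists v : 'rV[{poly F}]_n, [/\ v != 0, laurent_mx v \in C & pwt v = d]) /\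
  (forall v : 'rV[{poly F}]_n, v != 0 -> laurent_mx v \in C -> (d <= pwt v)%N).

(* Here k <= n and 1 <= k, so that truncated subtraction is harmless. *)
Definition singleton_bound (n k delta : nat) : nat :=
  ((n - k) * (delta %/ k + 1) + delta + 1)%N.

Definition MDS_code (n k delta m : nat) (C : {vspace 'rV[laurent F]_n}) : Prop :=
  convolutional_code_mem k delta m C /\
  is_distance C (singleton_bound n k delta).

End ConvolutionalCodes.

Arguments convolutional_code {F} n k delta C.
Arguments convolutional_code_mem {F} n k delta m C.
Arguments MDS_code {F} n k delta m C.

(* Main.v *)
(* Let nu_j be the row degrees of a minimal generator matrix G.  For every M, the
   words uG with u polynomial and deg u_j < M - nu_j form a block code of length
   nM, of dimension sum_j max(M - nu_j, 0) >= kM - delta and of distance at least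
   d.  An [N, K, d] block code with K >= 2 satisfies
   (q + 1) d <= q (N - K + 2): shorten it at K - 2 positions, then average the
   weights of the nonzero words of a two-dimensional subcode.
   Write delta = ak + r with r < k.  If r = k - 1, which holds whenever k = 1 or
   km = delta + 1, take M = a + 2 and K = k + 1.  Otherwise take M = a + 1, with
   K = k - r if this is at least 2; if k - r = 1 then km <> delta + 1 forces
   m >= a + 2, the terms truncated to 0 give at least one more dimension, and
   K = 2 gives a contradiction. *)
Require Import Defs.
From mathcomp Require Import all_boot all_order all_algebra.
From mathcomp Require Import zify ring.

Set Implicit Arguments.
Unset Strict Implicit.
Unset Printing Implicit Defensive.

Import Order.TTheory GRing.Theory Num.Theory.
Local Open Scope ring_scope.

(** * A Plotkin-type bound for block codes *)

Lemma card_nonkernel_row2 (F : finFieldType) (c : 'cV[F]_2) :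
  (#|[set x : 'rV[F]_2 | (x *m c) 0%R 0%R != 0%R]| <= #|F| ^ 2 - #|F|)%N.
Proof.
pose Z := [set x : 'rV[F]_2 | (x *m c) 0 0 == 0].
have [y y0 yc] : exists2 y : 'rV[F]_2, y != 0 & y *m c = 0.
  have: (0 < \rank (kermx c))%N.
    by rewrite mxrank_ker; have := rank_leq_col c; lia.
  rewrite lt0n mxrank_eq0 => /rowV0Pn[y yc y0]; exists y => //.
  exact/sub_kermxP.
have leZ : (#|F| <= #|Z|)%N.
  rewrite -[X in (X <= _)%N](@card_imset _ _ (fun a : F => a *: y)).
    apply/subset_leq_card/subsetP => _ /imsetP[a _ ->].
    by rewrite inE -scalemxAl yc scaler0 mxE.
  move=> a b /eqP; rewrite -subr_eq0 -scalerBl scaler_eq0 (negPf y0) orbF.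
  by rewrite subr_eq0 => /eqP.
have -> : [set x : 'rV[F]_2 | (x *m c) 0 0 != 0] = ~: Z.
  by apply/setP => x; rewrite !inE.
by rewrite cardsCs setCK card_mx mul1n leq_sub2l.
Qed.

Lemma wt_sum (F : finFieldType) (n : nat) (w : 'rV[F]_n) :
  wt w = (\sum_(i < n) (w 0%R i != 0%R))%N.
Proof.
by rewrite /wt -sum1dep_card big_mkcond; apply: eq_bigr => i _; case: eqP.
Qed.

(** Double counting of the total weight of the [q ^ 2 - 1] nonzero messages: a column outside [T] is
    nonzero on at most [q ^ 2 - q] of them, and a factor [q - 1] cancels. *)
Lemma plotkin_row2 (F : finFieldType) (N d : nat) (B : 'M[F]_(2, N))
    (T : {set 'I_N}) :
  (forall x : 'rV[F]_2, x != 0 -> (d <= wt (x *m B))%N) ->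
  (forall i, i \in T -> col i B = 0) ->
  ((#|F| + 1) * d + #|F| * #|T| <= #|F| * N)%N.
Proof.
move=> dB BT; have q1 := card_finNzRing_gt1 F; set q := #|F| in q1 *.
have TN : (#|T| <= N)%N by have := max_card (mem T); rewrite card_ord.
have lower : ((q ^ 2 - 1) * d <= \sum_(x : 'rV[F]_2 | x != 0%R) wt (x *m B))%N.
  have <- : #|[pred x : 'rV[F]_2 | x != 0]| = (q ^ 2 - 1)%N.
    by have := cardC1 (0 : 'rV[F]_2); rewrite card_mx mul1n subn1 => <-.
  by rewrite -sum_nat_const; apply: leq_sum.
have upper : (\sum_(x : 'rV[F]_2 | x != 0%R) wt (x *m B)
    <= (N - #|T|) * (q ^ 2 - q))%N.
  apply: (@leq_trans (\sum_(x : 'rV[F]_2) wt (x *m B))%N).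
    by rewrite [leqRHS](bigID (fun x => x != 0%R)) leq_addr.
  have -> : (\sum_(x : 'rV[F]_2) wt (x *m B) =
      \sum_(i < N) #|[set x : 'rV[F]_2 | (x *m col i B) 0%R 0%R != 0%R]|)%N.
    transitivity (\sum_(x : 'rV[F]_2) \sum_(i < N)
        ((x *m B) 0%R i != 0%R : nat))%N.
      by apply: eq_bigr => x _; rewrite wt_sum.
    rewrite exchange_big /=; apply: eq_bigr => i _.
    rewrite -sum1dep_card [RHS]big_mkcond; apply: eq_bigr => x _.
    by rewrite colE mulmxA -colE [col _ _ _ _]mxE; case: eqP.
  rewrite (bigID (mem T)) /= [X in (X + _)%N]big1 => [|i iT]; last first.
    by apply: eq_card0 => x; rewrite inE BT // mulmx0 mxE eqxx.
  rewrite add0n.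
  have -> : (N - #|T| = #|[pred i | i \notin T]|)%N.
    by apply/eqP; rewrite -(eqn_add2l #|T|) subnKC ?(cardC (mem T)) ?card_ord.
  by rewrite -sum_nat_const; apply: leq_sum => i _; apply: card_nonkernel_row2.
have := leq_trans lower upper.
have -> : (q ^ 2 - 1 = (q - 1) * (q + 1))%N by nia.
have -> : (q ^ 2 - q = (q - 1) * q)%N by nia.
rewrite mulnCA -mulnA leq_pmul2l; last by lia.
nia.
Qed.

Lemma plotkin_shortened (F : finFieldType) (K N d : nat) (E : 'M[F]_(K, N)) :
  (2 <= K)%N -> (0 < d)%N ->
  (forall x : 'rV[F]_K, x != 0 -> (d <= wt (x *m E))%N) ->
  ((#|F| + 1) * d + #|F| * K <= #|F| * (N + 2))%N.
Proof.
move=> K2 d0 dE.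
pose T : {set 'I_N} := [set i in take (K - 2) (enum 'I_N)].
have cT : #|T| = minn (K - 2) N.
  rewrite cardsE (card_uniqP (take_uniq _ (enum_uniq _))) size_take.
  by rewrite size_enum_ord /minn.
pose A := colsub (fun i : 'I_#|T| => enum_val i) E.
pose R := row_base (kermx A).
have rk : (2 <= \rank (kermx A))%N.
  by rewrite mxrank_ker; have := rank_leq_col A; lia.
(* [pid_mx 2] keeps two basis vectors of the messages whose codewords vanish on [T]. *)
pose B := (pid_mx 2 : 'M[F]_(2, _)) *m R.
have BA : B *m A = 0.
  have /sub_kermxP RA : (R <= kermx A)%MS by rewrite eq_row_base.
  by rewrite -mulmxA RA mulmx0.
have freeB : row_free B.
  by rewrite /row_free mxrankMfree ?row_base_free // rank_pid_mx.
have : ((#|F| + 1) * d + #|F| * #|T| <= #|F| * N)%N.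
  apply: (@plotkin_row2 _ _ _ (B *m E)) => [x x0|i iT].
    by rewrite mulmxA; apply: dE; rewrite mulmx_free_eq0.
  rewrite colE -mulmxA -colE.
  have -> : col i E = col (enum_rank_in iT i) A.
    by apply/colP => j; rewrite !mxE enum_rankK_in.
  by rewrite colE mulmxA BA mul0mx.
(* If [N < K - 2], all positions would be in [T], and [H] would force [d = 0]. *)
rewrite cT => H; have : (minn (K - 2) N = K - 2)%N by nia.
move=> E2; rewrite E2 in H; nia.
Qed.

(** * Invariance of the complexity under change of generator matrix *)

Lemma laurent_of_poly_inj (F : fieldType) : injective (@laurent_of_poly F).
Proof.
move=> p q pq; apply/polyP => i.
by have /(congr1 (fun f : laurent F => f (Posz i))) := pq.
Qed.

Lemma laurent_mx_inj (F : finFieldType) (m n : nat) :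
  injective (@laurent_mx F m n).
Proof.
move=> A B /matrixP AB; apply/matrixP => i j; apply: laurent_of_poly_inj.
by have := AB i j; rewrite !mxE.
Qed.

Lemma complexity_mull (F : finFieldType) (k n : nat) (V : 'M[{poly F}]_k)
    (G : 'M[{poly F}]_(k, n)) :
  V \in unitmx -> complexity (V *m G) = complexity G.
Proof.
rewrite unitmxE poly_unitE => /andP[/size_poly1P[c c0 Vc] _].
apply: eq_bigr => f _.
by rewrite -mulmx_colsub det_mulmx Vc size_Cmul.
Qed.

(** Each row of [G'] is [u *m G] with [u] over Laurent series; multiplying by the polynomial right
    inverse [H] recovers [u], which is therefore polynomial. *)
Lemma generator_factor (F : finFieldType) (n k : nat)
    (C : {vspace 'rV[laurent F]_n}) (G G' : 'M[{poly F}]_(k, n)) :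
  is_generator C G -> is_generator C G' ->
  exists V : 'M[{poly F}]_k, G' = V *m G.
Proof.
move=> [[H GH] CG] [_ CG']; exists (G' *m H).
have lGH : laurent_mx G *m laurent_mx H = 1%:M.
  by rewrite -map_mxM GH map_mx1.
apply: laurent_mx_inj.
rewrite /laurent_mx !map_mxM; apply/row_matrixP => i.
have /CG[u uE] : row i (laurent_mx G') \in C.
  by apply/CG'; exists (delta_mx 0 i); rewrite rowE.
by rewrite !row_mul uE -(mulmxA u) -/(laurent_mx H) lGH mulmx1.
Qed.

(** Needed because [delta] and the memory may be witnessed by different generator matrices. The two
    transition matrices are mutually inverse, as [G] can be cancelled on the right. *)
Lemma complexity_generator (F : finFieldType) (n k : nat)
    (C : {vspace 'rV[laurent F]_n}) (G G' : 'M[{poly F}]_(k, n)) :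
  is_generator C G -> is_generator C G' -> complexity G = complexity G'.
Proof.
move=> gG gG'; have [V VE] := generator_factor gG gG'.
have [W WE] := generator_factor gG' gG.
have [[H GH] _] := gG.
have /mulmx1C/mulmx1_unit[uV _] : W *m V = 1%:M.
  by rewrite -[LHS]mulmx1 -GH !mulmxA -(mulmxA W) -VE -WE GH.
by rewrite VE complexity_mull.
Qed.

(** * The block code of words of bounded degree *)

Lemma size_row_deg (F : finFieldType) (k n : nat) (G : 'M[{poly F}]_(k, n))
    (i : 'I_k) (j : 'I_n) :
  (size (G i j) <= (row_deg G i).+1)%N.
Proof.
have := @leq_bigmax 'I_n (fun l => (size (row i G 0%R l)).-1) j.
by rewrite /= mxE => le_deg; apply: leq_trans (leqSpred _) _.
Qed.

Lemma pwt_trunc (F : finFieldType) (n M : nat) (v : 'rV[{poly F}]_n) :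
  v != 0 -> (forall i, (size (v 0%R i) <= M)%N) ->
  (pwt v <= \sum_(t < M) wt (vcoef v t))%N.
Proof.
move=> /rV0Pn[i0 vi0] vM; have M0 : (0 < M)%N.
  by apply: leq_trans (vM i0); rewrite size_poly_gt0.
have vd : ((vdeg v).+1 <= M)%N.
  rewrite -[M]prednK // ltnS; apply/bigmax_leqP => i _.
  by have := vM i; lia.
by rewrite /pwt (big_ord_widen M (fun t => wt (vcoef v t)) vd) big_mkcond
  leq_sum // => t _; case: ifP.
Qed.

Lemma truncated_code_bound (F : finFieldType) (n k d K M : nat)
    (C : {vspace 'rV[laurent F]_n}) (G : 'M[{poly F}]_(k, n)) :
  is_generator C G -> is_distance C d -> (0 < d)%N ->
  (2 <= K <= \sum_(j < k) (M - row_deg G j))%N ->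
  ((#|F| + 1) * d + #|F| * K <= #|F| * (n * M + 2))%N.
Proof.
move=> [[H GH] CG] [_ dmin] d0 /andP[K2 KS].
(* The pair [(j, t)] stands for the message [z^t] in position [j]; truncated subtraction leaves no
   message for rows of degree at least [M]. *)
pose P := [set p : 'I_k * 'I_M | (p.2 < M - row_deg G p.1)%N].
have cP : #|P| = (\sum_(j < k) (M - row_deg G j))%N.
  rewrite -sum1dep_card -(pair_big_dep xpredT
    (fun j (t : 'I_M) => (t < M - row_deg G j)%N) (fun _ _ => 1%N)) /=.
  apply: eq_bigr => j _; rewrite -(big_ord_widen_cond _ xpredT (fun=> 1%N)).
    by rewrite sum1_card card_ord.
  exact: leq_subr.
(* p encodes the message with the single entry z^(s p), in position r p *)
pose s (p : 'I_#|P|) : nat := (enum_val p).2.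
pose r (p : 'I_#|P|) : 'I_k := (enum_val p).1.
have sr_inj p p' : s p = s p' -> r p = r p' -> p = p'.
  move=> es er; apply: enum_val_inj.
  rewrite [LHS]surjective_pairing [RHS]surjective_pairing.
  by congr pair; [exact: er | exact: val_inj].
have lt_s p : (s p < M - row_deg G (r p))%N.
  by have := enum_valP p; rewrite inE.
pose D : 'M[{poly F}]_(#|P|, k) := \matrix_p ('X^(s p) *: delta_mx 0 (r p)).
pose E : 'M[F]_(#|P|, n * M) :=
  \matrix_p mxvec (\matrix_(i, t) ((D *m G) p i)`_(t : 'I_M)).
suff dE x : x != 0 -> (d <= wt (x *m E))%N.
  have P2 : (2 <= #|P|)%N by rewrite cP (leq_trans K2).
  apply: leq_trans (plotkin_shortened P2 d0 dE).
  by rewrite leq_add2l leq_mul2l cP KS orbT.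
move=> x0; pose u := map_mx polyC x *m D; pose v := u *m G.
have DG p i : (D *m G) p i = 'X^(s p) * G (r p) i.
  transitivity (row p (D *m G) 0 i); first by rewrite [RHS]mxE.
  by rewrite row_mul rowK -scalemxAl -rowE !mxE.
have vE i t : (v 0 i)`_t = \sum_p x 0 p * ((D *m G) p i)`_t.
  rewrite /v /u -mulmxA mxE coef_sum.
  by apply: eq_bigr => p _; rewrite mxE coefCM.
(* The right inverse recovers [u] from [v], and [x 0 p] is the coefficient of [z^(s p)] in entry
   [r p] of [u]. *)
have v0 : v != 0.
  have /rV0Pn[p xp] := x0; apply: contra_neq xp => v0.
  have u0 : u = 0 by rewrite -[u]mulmx1 -GH mulmxA -/v v0 mul0mx.
  have := congr1 (fun w : 'rV[{poly F}]_k => (w 0 (r p))`_(s p)) u0.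
  rewrite !mxE coef0 coef_sum => <-.
  rewrite (bigD1 p) //= big1 => [|p' pp']; last first.
    rewrite !mxE coefCM eqxx; case: eqP => [rE|_]; last first.
      by rewrite mulr0 coef0 mulr0.
    rewrite mulr1 coefXn; case: eqP => [sE|_]; last by rewrite mulr0.
    by rewrite (sr_inj _ _ sE rE) eqxx in pp'.
  by rewrite !mxE coefCM !eqxx mulr1 coefXn eqxx mulr1 addr0.
have vM i : (size (v 0%R i) <= M)%N.
  apply/leq_sizeP => t Mt; rewrite vE big1 // => p _.
  rewrite DG nth_default ?mulr0 //; apply: leq_trans Mt.
  rewrite mulrC; apply: leq_trans (size_polyMleq _ _) _; rewrite size_polyXn.
  by have := lt_s p; have := size_row_deg G (r p) i; lia.
have vC : laurent_mx v \in C.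
  by apply/CG; exists (laurent_mx u); rewrite -map_mxM.
apply: leq_trans (dmin v v0 vC) _; apply: leq_trans (pwt_trunc v0 vM) _.
rewrite [leqRHS]wt_sum.
rewrite (reindex _ (curry_mxvec_bij _ _)) /=.
rewrite (eq_bigr (fun p : 'I_n * 'I_M => ((v 0%R p.1)`_p.2 != 0%R) : nat)).
  rewrite -(pair_bigA _ (fun i (t : 'I_M) => ((v 0%R i)`_t != 0%R) : nat)) /=.
  rewrite exchange_big leq_sum // => t _.
  by rewrite wt_sum leq_sum // => i _; rewrite mxE.
move=> [i t] _ /=; rewrite vE mxE; congr (nat_of_bool (_ != 0)).
by apply: eq_bigr => p _; rewrite [E p _]mxE mxvecE [in LHS]mxE.
Qed.

(** * Counting messages, and the field size bounds *)

Lemma sum_subn_max (k M : nat) (nu : 'I_k -> nat) :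
  (0 < k)%N ->
  (k * M + (\max_j nu j - M) <= \sum_j (M - nu j) + \sum_j nu j)%N.
Proof.
move=> k0; have [|j0 ->] := @bigop.eq_bigmax 'I_k nu; first by rewrite card_ord.
have -> : (k * M = \sum_(j < k) M)%N by rewrite sum_nat_const card_ord.
rewrite -big_split /=.
(* Termwise [M <= (M - nu j) + nu j]; at the index [j0] of the maximum, truncation leaves the
   surplus [nu j0 - M]. *)
rewrite (bigD1 j0) // [leqRHS](bigD1 j0) //=.
rewrite addnAC leq_add //; first by lia.
by apply: leq_sum => j _; lia.
Qed.

Lemma sum_leq_max (k : nat) (nu : 'I_k -> nat) :
  (\sum_j nu j <= k * \max_j nu j)%N.
Proof.
rewrite -[k in (k * _)%N]card_ord -sum_nat_const.
by apply: leq_sum => j _; apply: leq_bigmax.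
Qed.

Lemma distance_unique (F : finFieldType) (n d d' : nat)
    (C : {vspace 'rV[laurent F]_n}) :
  is_distance C d -> is_distance C d' -> d = d'.
Proof.
move=> [[v [v0 vC <-]] dmin] [[w [w0 wC <-]] dmin'].
by apply/eqP; rewrite eqn_leq dmin // dmin'.
Qed.

Theorem theorem3p7 (F : finFieldType) (n k delta m d : nat)
    (C : {vspace 'rV[laurent F]_n})
    (C_mds : MDS_code n k delta m C) (C_dist : is_distance C d) :
  ((k = 1%N \/ (1 < k)%N /\ (k * m = delta + 1)%N) ->
     d%:R / (n - k + 1)%N%:R <= #|F|%:R :> rat) /\
  ((1 < k)%N /\ (k * m <> delta + 1)%N -> (d <= #|F|)%N).
Proof.
have [[[k0 dimC [G0 [gG0 G0delta]]] [G [[gG Gmin] mE]]] C_S] := C_mds.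
have nu_sum : (\sum_j row_deg G j = delta)%N.
  by rewrite -Gmin -G0delta (complexity_generator gG gG0).
have kn : (k <= n)%N.
  have := dimvS (subvf C); rewrite dimC dimvf.
  by rewrite dim_matrix mul1r.
have := distance_unique C_dist C_S; rewrite /singleton_bound => dE.
have dgt0 : (0 < d)%N by rewrite dE addn1.
have km : (delta <= k * m)%N by rewrite mE -nu_sum sum_leq_max.
set a := (delta %/ k)%N in dE.
have [r rk delta_ar] : exists2 r, (r < k)%N & delta = (a * k + r)%N.
  by exists (delta %% k)%N; rewrite ?ltn_mod // -divn_eq.
have code_bound K M : (2 <= K)%N -> (K + delta <= k * M + (m - M))%N ->
    ((#|F| + 1) * d + #|F| * K <= #|F| * (n * M + 2))%N.
  move=> K2 KM; apply: (truncated_code_bound gG C_dist dgt0).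
  rewrite K2 -(leq_add2r delta) (leq_trans KM) //= -nu_sum mE.
  exact: sum_subn_max.
have [e nE] : exists e, n = (k + e)%N by exists (n - k)%N; lia.
have nkE : (n - k = e)%N by lia.
rewrite nkE in dE *.
split=> [cases|[k1 km_ne]].
- have r_max : (r + 1 = k)%N.
    case: cases => [|[k1 kmE]]; first by lia.
    (* From [a < m] follows [k * (a + 1) <= k * m = a * k + r + 1], hence [k <= r + 1]. *)
    have a_lt_m : (a < m)%N by rewrite -(ltn_pmul2l k0); lia.
    have := leq_mul (leqnn k) a_lt_m; lia.
  have dn : d = (n * (a + 1))%N by rewrite dE delta_ar nE -r_max; ring.
  rewrite ler_pdivrMr ?ltr0n ?addn1 // -natrM ler_nat.
  have K2 : (2 <= k + 1)%N by lia.
  (* With [r = k - 1], [k * (a + 2) - delta] is exactly [k + 1]; the bound then reduces to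
     [n * (a + 1) <= q * (n - k + 1)]. *)
  have KM : (k + 1 + delta <= k * (a + 2) + (m - (a + 2)))%N by lia.
  have := code_bound _ _ K2 KM; rewrite dn nE; lia.
- have [s sE] : exists s, (k - r = s + 1)%N by exists (k - r - 1)%N; lia.
  have nE' : (n * (a + 1) = d + s)%N by lia.
  have [s0|s_gt0] := posnP s.
    have a_lt_m : (a < m)%N by rewrite -(ltn_pmul2l k0); lia.
    (* Here [r = k - 1], so [m = a + 1] would give [k * m = delta + 1]. The surplus [m - (a + 1)]
       raises the dimension to 2, and the bound becomes [d <= 0]. *)
    have m_ge : (a + 2 <= m)%N.
      by rewrite addn2 ltn_neqAle a_lt_m andbT; apply/eqP => mE'; lia.
    have KM : (2 + delta <= k * (a + 1) + (m - (a + 1)))%N by lia.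
    by have := code_bound _ _ (leqnn 2) KM; lia.
  have K2 : (2 <= s + 1)%N by lia.
  have KM : (s + 1 + delta <= k * (a + 1) + (m - (a + 1)))%N by lia.
  (* The length is [d + s] and the dimension [s + 1], so [(q + 1) * d + q * (s + 1) <= q * (d + s +
     2)], that is [d <= q]. *)
  by have := code_bound _ _ K2 KM; rewrite nE'; lia.
Qed.
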